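(* Let $\mathcal{F}_t$ be the family of forests. Then the game $BS_n(\mathcal{F}_t : t_1, t_2, \dots, t_n)$ ends after exactly $n-1$ moves.
   Context: A set of graphs $\mathcal{F}$ is a hereditary class if every graph isomorphic to an induced subgraph of a graph in $\mathcal{F}$ belongs to $\mathcal{F}$. For a hereditary class $\mathcal{F}$, the game $BS_n(\mathcal{F}:t_1,\dots,t_n)$ ($n$-Brussels sprout for $\mathcal{F}$ with parameters $(t_1,\dots,t_n)$) is the following two-player pen and paper game. It starts with $n$ spots having $t_1, \dots, t_n$ open tips (free partial edges coming out of the spot), respectively. The players move alternately. A valid move consists of joining two open tips with a curve, followed by drawing a crossbar on the curve to create two new open tips. The graph obtained by taking the spots and the intersections of a curve and a crossbar as vertices, and the curves joining two such vertices as edges, must remain inside the family $\mathcal{F}$ at all times. The first player unable to provide a valid move loses. The number of moves is the total number of moves made by both players.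
   Formalization: The formal statement assumes n ≥ 1 and that every spot starts with at least one open tip (all t_i ≥ 1); without this the claim fails, e.g. n = 2 with t = (0,0) allows no move although n − 1 = 1. *)

(* Defs.v *)
From HB Require Import structures.
From mathcomp Require Import all_boot.

Set Implicit Arguments.
Unset Strict Implicit.
Unset Printing Implicit Defensive.

(* Finite undirected multigraphs, loops and parallel edges allowed: [ends] lists
   the two ends of an edge in an irrelevant order.  Multiplicities cannot be
   dropped: joining two tips of the same vertex produces two parallel edges. *)
Record multigraph := Multigraph {
  vertex : finType;
  edge : finType;
  ends : edge -> vertex * vertex }.

Definition joins (G : multigraph) (e : edge G) (x y : vertex G) : bool :=
  (ends e == (x, y)) || (ends e == (y, x)).

Definition isomorphic (G H : multigraph) : Prop :=
  exists (f : vertex G -> vertex H) (g : edge G -> edge H),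
    [/\ bijective f, bijective g
      & forall e x y, joins (g e) (f x) (f y) = joins e x y].

Definition edge_inside (G : multigraph) (A : {set vertex G}) (e : edge G) : bool :=
  ((ends e).1 \in A) && ((ends e).2 \in A).

Definition induced_subgraph (G : multigraph) (A : {set vertex G}) : multigraph :=
  @Multigraph {x : vertex G | x \in A} {e : edge G | edge_inside A e}
    (fun e => (exist (fun x => x \in A) (ends (val e)).1 (proj1 (andP (valP e))),
               exist (fun x => x \in A) (ends (val e)).2 (proj2 (andP (valP e))))).

Definition hereditary (F : multigraph -> Prop) : Prop :=
  forall (G : multigraph) (A : {set vertex G}) (H : multigraph),
    F G -> isomorphic H (induced_subgraph A) -> F H.

Record hereditary_class := HereditaryClass {
  in_class :> multigraph -> Prop;
  in_class_hereditary : hereditary in_class }.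

(* The sequence (v_0, e_0), ..., (v_k, e_k) encodes the cycle
   v_0 e_0 v_1 e_1 ... v_k e_k v_0; a loop is a cycle of length 1 and two
   parallel edges form a cycle of length 2. *)
Definition graph_cycle (G : multigraph) (c : seq (vertex G * edge G)) : bool :=
  [&& c != [::], cycle (fun p q => joins p.2 p.1 q.1) c,
      uniq (unzip1 c) & uniq (unzip2 c)].

Definition forest (G : multigraph) : Prop :=
  forall c : seq (vertex G * edge G), ~~ graph_cycle c.

Lemma forest_hereditary : hereditary forest.
Proof.
move=> G A H forG [f [g [bf bg fg]]] c; apply/negP => /and4P[c0 cc u1 u2].
have If := inj_comp val_inj (bij_inj bf).
have Ig := inj_comp val_inj (bij_inj bg).
pose h (p : vertex H * edge H) := (val (f p.1), val (g p.2)).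
have /negP[] := forG (map h c); apply/and4P; split.
- by case: c c0 {cc u1 u2}.
- rewrite cycle_map; apply: sub_cycle cc => p q /=; rewrite -fg /joins /=.
  by case/orP => /eqP[<- <-]; rewrite -surjective_pairing eqxx ?orbT.
- by rewrite /unzip1 -map_comp (map_comp (val \o f) fst) map_inj_uniq.
- by rewrite /unzip2 -map_comp (map_comp (val \o g) snd) map_inj_uniq.
Qed.

Definition forests : hereditary_class := HereditaryClass forest_hereditary.

Record position := Position {
  graph : multigraph;
  tip : finType;
  tip_vertex : tip -> vertex graph }.

Definition start (n : nat) (t : 'I_n -> nat) : position :=
  @Position (@Multigraph 'I_n void (fun e => match e with end))
    {i : 'I_n & 'I_(t i)} (fun x => tag x).

(* Joining the tips [a] and [b] by a curve with a crossbar: the intersection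
   with the crossbar is the new vertex [None], which splits the curve into the
   edges [inr false] and [inr true]; [a] and [b] are no longer open, and the two
   ends of the crossbar are the new tips [inr false] and [inr true]. *)
Definition draw_graph (p : position) (a b : tip p) : multigraph :=
  @Multigraph (option (vertex (graph p))) (edge (graph p) + bool)%type
    (fun e => match e with
              | inl e0 => (Some (ends e0).1, Some (ends e0).2)
              | inr false => (Some (tip_vertex a), None)
              | inr true => (None, Some (tip_vertex b))
              end).

Definition draw (p : position) (a b : tip p) : position :=
  @Position (draw_graph a b) ({x : tip p | (x != a) && (x != b)} + bool)%type
    (fun x => match x with
              | inl y => Some (tip_vertex (val y))
              | inr _ => None
              end).

Section Game.
Variable F : hereditary_class.

Definition valid_move (p : position) (a b : tip p) : Prop :=
  a != b /\ F (graph (draw a b)).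

Definition game_over (p : position) : Prop :=
  forall a b : tip p, ~ valid_move a b.

(* [play p k q]: some k successive valid moves, by the two players together,
   lead from p to q. *)
Inductive play (p : position) : nat -> position -> Prop :=
| play_start : play p 0 p
| play_move k q (a b : tip q) :
    play p k q -> valid_move a b -> play p k.+1 (draw a b).

(* However the players move in BS_n(F : t_1, ..., t_n), no more than m moves can
   be made, and the player to move is stuck exactly when m moves have been made. *)
Definition BS_ends_after_exactly (n : nat) (t : 'I_n -> nat) (m : nat) : Prop :=
  forall (k : nat) (q : position),
    play (start t) k q -> k <= m /\ (game_over q <-> k = m).

End Game.

(* Main.v *)
Require Import Defs.
From mathcomp Require Import all_boot.

(* Label every vertex by its connected component.  A move keeps the graph a
   forest iff it joins tips of two distinct components: inside a component it
   closes a cycle, and between two components both new edges are bridges.  A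
   valid move therefore merges two components, and the crossbar gives the merged
   component new open tips; so every component always has an open tip, and the
   game stops exactly when a single component is left. *)

Set Implicit Arguments.
Unset Strict Implicit.
Unset Printing Implicit Defensive.

Definition adjacent (G : multigraph) : rel (vertex G) :=
  fun x y => [exists e : edge G, joins e x y].

Lemma joinsC (G : multigraph) (e : edge G) x y : joins e x y = joins e y x.
Proof. by rewrite /joins orbC. Qed.

Lemma joins_mem (G : multigraph) (e : edge G) x y u v :
  joins e x y -> joins e u v -> x = u \/ x = v.
Proof. by rewrite /joins => /orP[] /eqP-> /orP[] /eqP[<- <-]; auto. Qed.

Lemma adjacent_connect_sym (G : multigraph) : connect_sym (@adjacent G).
Proof.
by apply: sym_connect_sym => x y; apply: eq_existsb => e; rewrite joinsC.
Qed.

Lemma connect_homo (T U : finType) (e : rel T) (e' : rel U) (f : T -> U) x y :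
  {homo f : u v / e u v >-> e' u v} -> connect e x y -> connect e' (f x) (f y).
Proof.
move=> fh /connectP[p pP ->]; apply/connectP; exists (map f p).
  by rewrite path_map; apply: sub_path pP => u v /fh.
by rewrite last_map.
Qed.

(* The vertices and edges of the walk are listed as in [graph_cycle], so the
   final vertex [y] is not in the list. *)
Fixpoint walk (G : multigraph) (x : vertex G) (w : seq (vertex G * edge G))
    (y : vertex G) : bool :=
  if w is (v, e) :: w' then (v == x) && [exists u, joins e x u && walk u w' y]
  else x == y.

(** A path can be shortened to one with distinct vertices. Its edges are then distinct too: the
    first edge has [x] as an end, while every later edge has both ends on the rest of the path,
    which avoids [x]. *)
Lemma connect_uniq_walk (G : multigraph) (x y : vertex G) :
  connect (@adjacent G) x y ->
  exists w, [/\ walk x w y, uniq (rcons (unzip1 w) y) & uniq (unzip2 w)].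
Proof.
case/connectP=> p0 /shortenP[p pP up _] -> {p0 y}.
suff [w [xw uw sw _]] : exists w : seq (vertex G * edge G),
   [/\ walk x w (last x p), uniq (unzip2 w),
     rcons (unzip1 w) (last x p) = x :: p
     & forall e, e \in unzip2 w ->
         exists u v, [/\ u \in x :: p, v \in x :: p & joins e u v]].
  by exists w; rewrite sw.
elim: p x pP up => [|y p IH] x.
  by exists [::]; split=> //=.
rewrite cons_uniq /= => /andP[/existsP[e exy] yp] /andP[xyp uyp].
have [w [yw uw sw ew]] := IH y yp uyp.
exists ((x, e) :: w); split=> /=.
- by rewrite eqxx; apply/existsP; exists y; rewrite exy.
- rewrite uw andbT; apply/negP => /ew[u [v [uyp' vyp' euv]]].
  by case: (joins_mem exy euv) xyp => ->; rewrite ?uyp' ?vyp'.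
- by rewrite sw.
- move=> e'; rewrite inE => /orP[/eqP->|/ew[u [v [up' vp' ?]]]].
    by exists x, y; rewrite exy !inE !eqxx orbT.
  by exists u, v; split; rewrite // in_cons ?up' ?vp' orbT.
Qed.

(** A simple walk between the two tip vertices closes up through the crossbar vertex. If both tips
    sit at one vertex, the walk may be empty and the two new edges form a cycle of length 2. *)
Lemma draw_connected_cyclic (p : position) (a b : tip p) :
  connect (@adjacent (graph p)) (tip_vertex a) (tip_vertex b) ->
  ~ forest (graph (draw a b)).
Proof.
case/connect_uniq_walk=> w [wP u1 u2]; pose D := graph (draw a b).
pose h (q : vertex (graph p) * edge (graph p)) : vertex D * edge D :=
  (Some q.1, inl q.2).
pose r (q q' : vertex D * edge D) := joins q.2 q.1 q'.1.
have hpath y x (q : vertex D * edge D) e' : joins q.2 q.1 (Some x) ->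
    walk x w y -> path r q (rcons (map h w) (Some y, e')).
  elim: w x q {wP u1 u2} => [|[v e] w IH] x q qx /=.
    by move=> /eqP <-; rewrite /r qx.
  case/andP=> /eqP-> /existsP[u /andP[eu uw]]; rewrite /r qx /=.
  by apply: IH uw; move: eu; rewrite /joins /= => /orP[] /eqP->;
     rewrite !eqxx ?orbT.
(* The cycle leaves [None] along [inr false], follows the walk from the vertex of [a] to that of
   [b], and returns along [inr true]. *)
move=> /(_ ((None, inr false) :: rcons (map h w) (Some (tip_vertex b), inr true))).
case/negP; apply/and4P; split=> //.
- rewrite [cycle _ _]rcons_path (hpath _ (tip_vertex a)) // ?last_rcons; last first.
    by rewrite /joins /= !eqxx.
  by rewrite /= /joins /= !eqxx.
- rewrite /unzip1 /= map_rcons -map_comp /=.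
  have -> : rcons (map (fst \o h) w) (Some (tip_vertex b)) =
            map Some (rcons (unzip1 w) (tip_vertex b)).
    by rewrite map_rcons /unzip1 -map_comp.
  rewrite map_inj_uniq ?u1 ?andbT; last by move=> ? ? [].
  by apply/mapP=> -[].
- rewrite /unzip2 /= map_rcons -map_comp /=.
  have -> : map (snd \o h) w = map inl (unzip2 w) by rewrite /unzip2 -map_comp.
  rewrite mem_rcons rcons_uniq inE map_inj_uniq ?u2 ?andbT; last by move=> ? ? [].
  by apply/andP; split; apply/mapP=> -[].
Qed.

(** The rest of a cycle through [e] would link the two ends of [e] by edges that preserve [g]. *)
Lemma bridge_notin_cycle (G : multigraph) (L : Type) (g : vertex G -> L)
    (e : edge G) c :
  (forall e', e' != e -> g (ends e').1 = g (ends e').2) ->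
  g (ends e).1 <> g (ends e).2 -> graph_cycle c -> e \notin unzip2 c.
Proof.
move=> gE ge /and4P[_ cc _ u2]; apply/negP=> /mapP[[v e'] vc /= ee'].
rewrite -{e'}ee' in vc.
(* Rotate the cycle to start with [e]; as its edges are distinct, [e] does not occur in the
   remainder [c']. *)
have [i c' rc] := rot_to vc.
have ne q : q \in c' -> q.2 != e.
  move=> qc; apply: contraTneq u2 => qe.
  rewrite -(rot_uniq i) /unzip2 -map_rot rc /= -qe.
  by rewrite (map_f snd qc).
have gj e1 x y : e1 != e -> joins e1 x y -> g x = g y.
  by move=> /gE + /orP[] /eqP E; rewrite E.
have gne x y : joins e x y -> g x <> g y.
  by move=> /orP[] /eqP E; rewrite E in ge => // gxy; apply: ge.
(* If [c'] is empty, [e] is a loop, which cannot change the value of [g]. *)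
move: cc; rewrite -(rot_cycle i) rc [cycle _ _]/=; case: c' ne {rc} => [|q c'] ne.
  by rewrite /= andbT => /gne.
rewrite rcons_cons /= => /andP[/gne vq qc]; apply: vq.
elim: c' q ne qc => [|q' c' IH] q ne /=.
  by rewrite andbT => /gj->//; apply: ne; rewrite mem_head.
case/andP=> qq' q'c; rewrite (gj _ _ _ _ qq') ?ne ?mem_head //.
rewrite (IH q') // => q1 q1c.
by apply: ne; rewrite inE q1c orbT.
Qed.

(** Neither new edge lies on a cycle, so any cycle would already be one of the old graph. *)
Lemma draw_disconnected_forest (p : position) (a b : tip p) (L : Type)
    (f : vertex (graph p) -> L) :
  forest (graph p) -> (forall e : edge (graph p), f (ends e).1 = f (ends e).2) ->
  f (tip_vertex a) <> f (tip_vertex b) -> forest (graph (draw a b)).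
Proof.
move=> forG fE fab c; apply/negP=> cP.
have nf : inr false \notin unzip2 c.
  (* With the value at [b] given to the crossbar vertex, [inr false] is the only edge along which
     the labelling changes; the value at [a] serves likewise for [inr true]. *)
  apply: (@bridge_notin_cycle (graph (draw a b)) L (oapp f (f (tip_vertex b)))) cP => //.
  by case=> [e|[]] //=.
have nt : inr true \notin unzip2 c.
  apply: (@bridge_notin_cycle (graph (draw a b)) L (oapp f (f (tip_vertex a)))) cP => //.
  by case=> [e|[]] //=.
case/and4P: cP => c0 cc u1 u2.
pose h (q : vertex (graph p) * edge (graph p)) :
  vertex (graph (draw a b)) * edge (graph (draw a b)) := (Some q.1, inl q.2).
have [c1 Ec] : exists c1, c = map h c1.
  (* Each vertex of the cycle is an end of the edge paired with it; that edge is old, so the vertex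
     is not [None]. *)
  have : forall q, q \in c -> exists q0, q = h q0.
    move=> [v [e|s]] qc; last by move: (map_f snd qc) nf nt => /=; case: s {qc} => ->.
    have := next_cycle cc qc; rewrite /joins /=.
    by case/orP=> /eqP[]; [move=> <- _; exists ((ends e).1, e)|move=> _ <-; exists ((ends e).2, e)].
  elim: c {c0 cc u1 u2 nf nt} => [|q c IH] hc; first by exists [::].
  have [q0 ->] := hc q (mem_head _ _).
  have [|c1 ->] := IH; last by exists (q0 :: c1).
  by move=> q' q'c; apply: hc; rewrite inE q'c orbT.
rewrite {}Ec in c0 cc u1 u2; have /negP[] := forG c1; apply/and4P; split.
- by case: c1 c0 {cc u1 u2}.
- move: cc; rewrite cycle_map; apply: sub_cycle => q q'.
  by rewrite /joins /= => /orP[] /eqP[<- <-]; rewrite -surjective_pairing eqxx ?orbT.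
- by move: u1; rewrite /unzip1 -map_comp (map_comp Some fst) map_inj_uniq // => ? ? [].
- by move: u2; rewrite /unzip2 -map_comp (map_comp inl snd) map_inj_uniq // => ? ? [].
Qed.

(** The fibres of [f] are the connected components and [A] is the set of labels in use, so [#|A|]
    counts components. The label type [L] stays fixed while the vertex type grows with each move. *)
Record component_labelling (L : finType) (p : position)
    (f : vertex (graph p) -> L) (A : {set L}) : Prop := ComponentLabelling {
  labelling_mem : forall x, f x \in A;
  labelling_tip : forall l, l \in A -> exists x : tip p, f (tip_vertex x) = l;
  labelling_edge : forall e : edge (graph p), f (ends e).1 = f (ends e).2;
  labelling_connect : forall x y, f x = f y -> connect (@adjacent (graph p)) x y }.

Lemma start_labelling (n : nat) (t : 'I_n -> nat) :
  (forall i, 0 < t i) ->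
  component_labelling (p := start t) id [set: 'I_n].
Proof.
move=> t0; split=> [x|l _|[]|x y ->]; rewrite ?inE ?connect0 //.
by exists (Tagged (fun i => 'I_(t i)) (Ordinal (t0 l))).
Qed.

(** The component of [b] and the crossbar vertex take the label of [a]. The merged component has the
    tips of the crossbar; any other keeps its tip, which is neither [a] nor [b]. *)
Lemma draw_labelling (L : finType) (p : position) (f : vertex (graph p) -> L)
    (A : {set L}) (a b : tip p) :
  component_labelling f A -> f (tip_vertex a) <> f (tip_vertex b) ->
  component_labelling (p := draw a b)
    (oapp (fun x => if f x == f (tip_vertex b) then f (tip_vertex a) else f x)
          (f (tip_vertex a)))
    (A :\ f (tip_vertex b)).
Proof.
move=> [fA ft fE fC] /eqP fab; pose D := graph (draw a b).
have liftC x y : f x = f y -> connect (@adjacent D) (Some x) (Some y).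
  move/fC; apply: connect_homo => u v /existsP[e euv].
  apply/existsP; exists (inl e); move: euv.
  by rewrite /joins /= => /orP[] /eqP->; rewrite eqxx ?orbT.
have aC : connect (@adjacent D) (Some (tip_vertex a)) None.
  by apply/connect1/existsP; exists (inr false); rewrite /joins eqxx.
have bC : connect (@adjacent D) (Some (tip_vertex b)) None.
  by apply/connect1/existsP; exists (inr true); rewrite /joins eqxx orbT.
split.
- by case=> [x|] /=; rewrite !inE; [case: ifP => [_|->]|]; rewrite ?fab ?fA.
- move=> l; rewrite !inE => /andP[lb /ft[x fx]].
  have [la|la] := eqVneq l (f (tip_vertex a)); first by exists (inr true).
  have xab : (x != a) && (x != b).
    by apply/andP; split; [apply: contraNneq la|apply: contraNneq lb] => <-; rewrite fx.
  by exists (inl (exist _ x xab)); rewrite /= fx (negPf lb).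
- by case=> [e|[]] /=; rewrite ?fE ?eqxx // (negPf fab).
(* The crossbar vertex is a hub: every vertex with the merged label reaches it, through the vertex
   of [a] or of [b]. *)
- have noneC x : (if f x == f (tip_vertex b) then f (tip_vertex a) else f x)
        = f (tip_vertex a) -> connect (@adjacent D) (Some x) None.
    by case: ifP => [/eqP xb _|_ xa]; [apply: connect_trans bC|apply: connect_trans aC];
       apply: liftC.
  have symC := @adjacent_connect_sym D.
  case=> [x|] [y|] //= fxy; last 2 first.
  + exact: noneC.
  + by rewrite symC noneC.
  have [xa|xa] := eqVneq (if f x == f (tip_vertex b) then f (tip_vertex a) else f x)
                         (f (tip_vertex a)).
    by apply: connect_trans (noneC x xa) _; rewrite symC noneC // -fxy.
  by move: xa fxy; do 2![case: ifP; rewrite ?eqxx //] => _ _ xa;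
     [move=> E; rewrite E eqxx in xa | apply: liftC].
Qed.

Lemma valid_move_labelling (L : finType) (p : position)
    (f : vertex (graph p) -> L) (A : {set L}) (a b : tip p) :
  forest (graph p) -> component_labelling f A ->
  valid_move forests a b <-> f (tip_vertex a) <> f (tip_vertex b).
Proof.
move=> forG [_ _ fE fC]; split=> [[_ forD] fab|fab].
  exact: (draw_connected_cyclic (fC _ _ fab)) forD.
split; first by apply/eqP=> ab; apply: fab; rewrite ab.
exact: draw_disconnected_forest forG fE fab.
Qed.

(** The invariant of the game: each move lowers the number of components by one, from [n] at the
    start. *)
Lemma play_labelling (n : nat) (t : 'I_n -> nat) (k : nat) (q : position) :
  0 < n -> (forall i, 0 < t i) -> play forests (start t) k q ->
  forest (graph q) /\
  exists (f : vertex (graph q) -> 'I_n) (A : {set 'I_n}),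
    [/\ component_labelling f A, 0 < #|A| & #|A| + k = n].
Proof.
move=> n0 t0; elim=> {k q} [|k q a b _ [forG [f [A [fA _ cA]]]] ab].
  split; first by case=> [|[_ []]].
  exists id, setT; rewrite cardsT card_ord addn0; split=> //.
  exact: start_labelling.
have fab := (valid_move_labelling a b forG fA).1 ab.
have gA := draw_labelling fA fab.
split; first by case: ab.
do 2!eexists; split; first exact: gA.
  by apply/card_gt0P; eexists; apply: (labelling_mem gA None).
by move: cA; rewrite (cardsD1 (f (tip_vertex b))) (labelling_mem fA) addnS.
Qed.

Theorem theorem2p1 (n : nat) (t : 'I_n -> nat) (hn : 0 < n)
    (ht : forall i : 'I_n, 0 < t i) :
  BS_ends_after_exactly forests t (n - 1).
Proof.
move=> k q /(play_labelling hn ht)[forG [f [A [fA A0 cA]]]].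
(* At least one component remains, which gives the bound on [k]; equality means that exactly one
   does. *)
have -> : n - 1 = #|A|.-1 + k by move: cA A0; case: #|A| => // m <- _; rewrite addSn subn1.
split; first by rewrite leq_addl.
split=> [over|kA a b /(valid_move_labelling a b forG fA)]; last first.
  have /eqP/cards1P[l Al] : #|A| = 1.
    by apply/eqP; rewrite -(prednK A0) eqSS -(eqn_add2r k) add0n -kA.
  have lE x : f x = l by have := labelling_mem fA x; rewrite Al => /set1P.
  by rewrite !lE.
(* Two labels in [A] would each have an open tip, and joining these would be a valid move. *)
suff -> : #|A| = 1 by [].
apply/eqP; rewrite eqn_leq A0 andbT leqNgt; apply/negP=> /card_gt1P[l [l' [lA l'A ll']]].
have [a fa] := labelling_tip fA lA; have [b fb] := labelling_tip fA l'A.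
apply: (over a b); apply/(valid_move_labelling a b forG fA).
by rewrite fa fb; apply/eqP.
Qed.
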